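(* Let $M\ge 2$. For any finite dictionary of probability densities $\mathcal P=\{p_1,\dots,p_M\}$ on a space $\mathcal X$ with respect to a measure $\mu$, and any $\varepsilon>0$, one has $$N_{\mathsf{loc}}\big(\operatorname{conv}(\mathcal P),\varepsilon\big)\le 64^{M-1}.$$
   Context: $\operatorname{conv}(\mathcal P)$ is the set of mixtures $\sum_{j=1}^M\theta_jp_j$ with $\theta_j\ge0$, $\sum_j\theta_j=1$. The Hellinger distance $\mathrm H(p,q)\ge 0$ between densities is defined by $\mathrm H^2(p,q)=\frac12\int_{\mathcal X}(\sqrt{p}-\sqrt{q})^2\,d\mu$. For a density $p$ and $r>0$, $B_{\mathrm H}(p,r)=\{q\text{ a density on }(\mathcal X,\mu):\mathrm H(p,q)\le r\}$. For a set $\mathcal F$ of densities and $\varepsilon>0$, $N_{\mathrm H}(\mathcal F,\varepsilon)$ is the covering number of $\mathcal F$ in the metric $\mathrm H$ at scale $\varepsilon$, i.e. the smallest cardinality of a subset $\mathcal F_0\subset\mathcal F$ such that every $f\in\mathcal F$ satisfies $\mathrm H(f,f_0)\le\varepsilon$ for some $f_0\in\mathcal F_0$. For a set $\mathcal G$ of densities, the local Hellinger entropy is $$N_{\mathsf{loc}}(\mathcal G,\varepsilon)=\sup_{p^\star\in\mathcal G}\ \sup_{\eta\ge\varepsilon}N_{\mathrm H}\big(B_{\mathrm H}(p^\star,\eta)\cap\mathcal G,\ \eta/2\big).$$ *)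

(* Defs.v *)
From HB Require Import structures.
From mathcomp Require Import all_boot all_order all_algebra.
From mathcomp Require Import all_classical all_reals all_analysis.

Set Implicit Arguments.
Unset Strict Implicit.
Unset Printing Implicit Defensive.

Import Order.TTheory GRing.Theory Num.Theory.
Import numFieldNormedType.Exports.

Local Open Scope classical_set_scope.
Local Open Scope ring_scope.

Section Hellinger.
Context {d : measure_display} {T : measurableType d} {R : realType}.
Variable mu : {measure set T -> \bar R}.

(* Densities are functions, not classes modulo mu-a.e. equality; [hellinger] is
   thus a pseudometric, which has the same covering numbers as its quotient. *)
Definition density : set (T -> R) :=
  [set p : T -> R | [/\ measurable_fun [set: T] p, forall x, 0 <= p x &
               (\int[mu]_x (p x)%:E)%E = 1%E]].

(* The integral is finite when p and q are densities, so the real-valued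
   integral loses nothing there. *)
Definition hellinger (p q : T -> R) : R :=
  Num.sqrt (2^-1 * \int[mu]_x ((Num.sqrt (p x) - Num.sqrt (q x)) ^+ 2)).

Definition hellinger_ball (p : T -> R) (r : R) : set (T -> R) :=
  [set q : T -> R | density q /\ hellinger p q <= r].

Definition hellinger_cover (F F0 : set (T -> R)) (eps : R) : Prop :=
  F0 `<=` F /\ forall f, F f -> exists2 f0, F0 f0 & hellinger f f0 <= eps.

(* [counting] sends every infinite set to +oo: the covering number is +oo
   exactly when no finite cover exists, and is otherwise the least cardinality
   of a cover. *)
Definition covering_number (F : set (T -> R)) (eps : R) : \bar R :=
  ereal_inf [set counting F0 | F0 in [set F0 | hellinger_cover F F0 eps]].

Definition local_entropy (G : set (T -> R)) (eps : R) : \bar R :=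
  ereal_sup [set ereal_sup
    [set covering_number (hellinger_ball p eta `&` G) (eta / 2)
    | eta in [set eta : R | eps <= eta]]
  | p in G].

End Hellinger.

Definition mixtures {T : Type} {R : realType} {M : nat} (p : 'I_M -> T -> R) :
    set (T -> R) :=
  [set (fun x => \sum_(j < M) theta j * p j x)
  | theta in [set theta : 'I_M -> R |
      (forall j, 0 <= theta j) /\ \sum_(j < M) theta j = 1]].

(* Main.v *)
(** Squared Hellinger distance is convex in each argument. Let [E] be the convex
    set of weights of the mixtures in a ball of radius [eta], and let
    [x 1, ..., x N] in [E] be [eta / 2]-separated. Since squared distances on [E]
    are at most [4 eta^2], the copies of [E] scaled by 1/64 towards each [x i]
    consist of mixtures within [eta / 4] of [x i]; they are therefore disjoint
    subsets of [E]. As [E] has nonempty interior in dimension [M - 1], comparing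
    volumes gives [N <= 64 ^ (M - 1)], and a separated family of maximal
    cardinality is a cover. *)
Require Import Defs.
From HB Require Import structures.
From mathcomp Require Import all_boot all_order all_algebra.
From mathcomp Require Import all_classical all_reals all_analysis.
From mathcomp Require Import measurable_realfun lra ring zify.

Set Implicit Arguments.
Unset Strict Implicit.
Unset Printing Implicit Defensive.

Import Order.TTheory GRing.Theory Num.Theory.
Import numFieldNormedType.Exports.
Local Open Scope classical_set_scope.
Local Open Scope ring_scope.

(** * Counting disjoint homothetic copies *)

(** If [B < N] with [B] positive, Bernoulli gives [(N / B) ^ k >= 1 + k / B], which exceeds [C] at
    [k = B * C]. This removes the bounded factor left by counting at a finite scale. *)
Lemma leq_of_expn_leq_mul (N B C : nat) :
  (forall k, N ^ k <= B ^ k * C)%N -> (N <= B)%N.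
Proof.
move=> NB; rewrite leqNgt; apply/negP => BN.
have bernoulli k : (B ^ k * (B + k) <= B * B.+1 ^ k)%N.
  elim: k => [|k IHk]; first by rewrite !expn0; lia.
  have : (B ^ k <= B.+1 ^ k)%N by case: k {IHk} => // k; rewrite leq_exp2r.
  by rewrite !expnS; nia.
case: (posnP B) => [B0|B_gt0].
  by have := NB 1%N; rewrite B0 expn1 mul0n; lia.
have := bernoulli (B * C)%N; have := NB (B * C)%N.
have : (B.+1 ^ (B * C) <= N ^ (B * C))%N
  by case: (B * C)%N => // k; rewrite leq_exp2r.
have : (0 < B ^ (B * C))%N by rewrite expn_gt0 B_gt0.
by move: (B ^ _)%N (B.+1 ^ _)%N (N ^ _)%N => ? ? ?; nia.
Qed.

(** As a function of [u], this is the homothety of centre [x] and ratio [t]. *)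
Definition segment {R : realType} {n : nat} (t : R) (x u : 'I_n -> R) :
  'I_n -> R := fun j => (1 - t) * x j + t * u j.

Lemma segment_inj {R : realType} {n : nat} (t : R) (x : 'I_n -> R) :
  t != 0 -> injective (segment t x).
Proof.
move=> t0 u v uv; apply/funext => j.
by have /(congr1 (fun f => f j))/addrI/(mulfI t0) := uv.
Qed.

Section DisjointHomothets.
Context {R : realType} {n m N : nat}.
Variables (E : set ('I_n -> R)) (x : 'I_N -> 'I_n -> R).
Hypothesis m_gt0 : (0 < m)%N.
Let t : R := m%:R^-1.
Hypothesis segmentE : forall i u, E u -> E (segment t (x i) u).
Hypothesis segment_disjoint : forall i j u v, E u -> E v ->
  segment t (x i) u = segment t (x j) v -> i = j.

Let iterated (w : seq 'I_N) (u : 'I_n -> R) :=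
  foldr (fun i => segment t (x i)) u w.

Let mR_gt0 : 0 < m%:R :> R. Proof. by rewrite ltr0n. Qed.
Let t_gt0 : 0 < t. Proof. by rewrite invr_gt0. Qed.

Let iterated_affine w u j :
  iterated w u j = iterated w (fun=> 0) j + t ^+ size w * u j.
Proof.
elim: w => [|i w IHw] /=; first by rewrite expr0 add0r mul1r.
by rewrite /segment IHw exprS; ring.
Qed.

Let iteratedE w u : E u -> E (iterated w u).
Proof. by move=> Eu; elim: w => //= i w /segmentE. Qed.

(** The inner points stay in [E], so the outermost letters agree by disjointness; injectivity of the
    homothety then cancels them. *)
Let iterated_disjoint w w' u v : size w = size w' -> E u -> E v ->
  iterated w u = iterated w' v -> w = w'.
Proof.
move=> + Eu Ev; elim: w w' => [|i w IHw] [|i' w'] //= [sz] eq_ww'.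
have eq_i : i = i' by apply: segment_disjoint eq_ww'; exact: iteratedE.
rewrite eq_i in eq_ww' *; congr cons; apply: IHw => //.
by apply: segment_inj eq_ww'; rewrite gt_eqF.
Qed.

(* The k-fold composites of the contractions have disjoint images, each
   containing a cube of side [m^-k s] and hence a point of the grid of that
   mesh; comparing the number [N ^ k] of images with the number of grid points
   in the unit cube as k tends to infinity replaces the comparison of
   Lebesgue measures. *)
Lemma card_disjoint_homothets (a : 'I_n -> R) (s : R) : 0 < s ->
  (forall u j, E u -> 0 <= u j <= 1) ->
  (forall u, (forall j, a j <= u j <= a j + s) -> E u) ->
  (N <= m ^ n)%N.
Proof.
(* As [S] exceeds [1 / s], the indices [b] with [m^-k * s * b <= 1] are at most [m ^ k * S]. The
   factor [S.+1 ^ n] does not depend on [k]. *)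
move=> s0 E01 cubeE; pose S := (Num.truncn s^-1).+1.
apply: (@leq_of_expn_leq_mul _ _ (S.+1 ^ n)) => k.
rewrite -expnM (mulnC n) expnM -expnMn.
have tk0 : 0 < t ^+ k by rewrite exprn_gt0.
pose h := t ^+ k * s; have h0 : 0 < h by rewrite mulr_gt0.
have Ea : E a by apply: cubeE => j; rewrite lexx lerDl ltW.
have gridP (w : k.-tuple 'I_N) :
    exists g : {ffun 'I_n -> 'I_(m ^ k * S.+1)%N}, exists2 v, E v &
      iterated w v = fun j => h * (g j)%:R.
  pose c j := iterated w (fun=> 0) j.
  (* The first grid index strictly past the lower corner of the image cube; that cube has side [h],
     so it contains the grid point. [v] is the preimage of this point. *)
  pose b j := (Num.truncn ((c j + t ^+ k * a j) / h)).+1.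
  pose v j := (h * (b j)%:R - c j) / t ^+ k.
  have c_ge0 j : 0 <= c j + t ^+ k * a j.
    by have /andP[+ _] := E01 _ j (iteratedE w Ea); rewrite iterated_affine size_tuple.
  have Ev : E v.
    apply: cubeE => j; rewrite ler_pdivlMr// ler_pdivrMr//.
    have := Num.Theory.truncn_itv (divr_ge0 (c_ge0 j) (ltW h0)).
    rewrite -/(b j) ler_pdivlMr// ltr_pdivrMr// => /andP[lo hi].
    have -> : (a j + s) * t ^+ k = t ^+ k * a j + h by rewrite /h; ring.
    move: lo; rewrite /b -natr1 in hi *; lra.
  have iteratedv : iterated w v = fun j => h * (b j)%:R.
    apply/funext => j; rewrite iterated_affine size_tuple /v -/(c j).
    by rewrite mulrC divfK ?gt_eqF//; ring.
  have b_lt j : (b j < m ^ k * S.+1)%N.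
    have /andP[_] := E01 _ j (iteratedE w Ev).
    rewrite iteratedv mulrC -ler_pdivlMr// div1r /h invfM /t exprVn invrK => bj.
    have : (b j <= m ^ k * S)%N.
      rewrite -(ler_nat R) natrM natrX (le_trans bj)// ler_wpM2l ?exprn_ge0 ?ler0n//.
      by rewrite ltW// /S truncnS_gt.
    by have : (0 < m ^ k)%N by [rewrite expn_gt0 m_gt0]; nia.
  exists [ffun j => Ordinal (b_lt j)]; exists v => //.
  by rewrite iteratedv; apply/funext => j; rewrite ffunE.
have [g gP] := choice gridP.
have ginj : injective g.
  move=> w w' eq_g; have [v Ev eqv] := gP w; have [v' Ev' eqv'] := gP w'.
  apply/val_inj/(iterated_disjoint (u := v) (v := v')) => //.
    by rewrite !size_tuple.
  by rewrite eqv eqv' eq_g.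
by have := leq_card g ginj; rewrite card_tuple card_ffun !card_ord.
Qed.

End DisjointHomothets.

(** * Squared Hellinger distance *)

(** After expanding the squares, the square terms are affine in the mixture and cancel; what remains
    is concavity of the square root, multiplied by the root of [c]. *)
Lemma sqrt_diff_sq_convex {R : realType} (a b c t : R) :
  0 <= a -> 0 <= b -> 0 <= t <= 1 ->
  (Num.sqrt c - Num.sqrt ((1 - t) * a + t * b)) ^+ 2 <=
  (1 - t) * (Num.sqrt c - Num.sqrt a) ^+ 2 +
  t * (Num.sqrt c - Num.sqrt b) ^+ 2.
Proof.
move=> a0 b0 /andP[t0 t1].
have t1' : 0 <= 1 - t by rewrite subr_ge0.
have m0 : 0 <= (1 - t) * a + t * b by rewrite addr_ge0 ?mulr_ge0.
have := sqr_sqrtr m0; have := sqr_sqrtr b0; have := sqr_sqrtr a0.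
have := sqrtr_ge0 ((1 - t) * a + t * b); have := sqrtr_ge0 c.
have := sqrtr_ge0 b; have := sqrtr_ge0 a.
move: (Num.sqrt a) (Num.sqrt b) (Num.sqrt c) (Num.sqrt (_ + _)) => A B C M.
move=> A0 B0 C0 M0 A2 B2; rewrite -A2 -B2 => M2.
have concave : (1 - t) * A + t * B <= M.
  rewrite -(@ler_pXn2r _ 2) ?nnegrE ?addr_ge0 ?mulr_ge0// M2 -subr_ge0.
  have -> : (1 - t) * A ^+ 2 + t * B ^+ 2 - ((1 - t) * A + t * B) ^+ 2 =
    (1 - t) * t * (A - B) ^+ 2 by ring.
  exact: mulr_ge0 (mulr_ge0 t1' t0) (sqr_ge0 _).
have := ler_wpM2l C0 concave.
by rewrite !sqrrB M2; lra.
Qed.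

Section HellingerTheory.
Context {d : measure_display} {T : measurableType d} {R : realType}.
Variable mu : {measure set T -> \bar R}.
Implicit Types p q r : T -> R.

Lemma density_integrable p : density mu p ->
  mu.-integrable [set: T] (EFin \o p).
Proof.
move=> [mp p0 int1]; apply/integrableP; split; first exact/measurable_EFinP.
under eq_integral => x _ do rewrite /= ger0_norm//.
by rewrite int1 ltry.
Qed.

Lemma integrable_EFin_linear (a b : R) (f g : T -> R) :
  mu.-integrable [set: T] (EFin \o f) -> mu.-integrable [set: T] (EFin \o g) ->
  mu.-integrable [set: T] (EFin \o (fun x => a * f x + b * g x)).
Proof.
by move=> intf intg; apply: (integrableD measurableT
  (integrableZl measurableT a intf) (integrableZl measurableT b intg)).
Qed.

Lemma Rintegral_linear (a b : R) (f g : T -> R) :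
  mu.-integrable [set: T] (EFin \o f) -> mu.-integrable [set: T] (EFin \o g) ->
  \int[mu]_x (a * f x + b * g x) = a * \int[mu]_x f x + b * \int[mu]_x g x.
Proof.
move=> intf intg; rewrite RintegralD// ?RintegralZl//.
- exact: (integrableZl measurableT a intf).
- exact: (integrableZl measurableT b intg).
Qed.

(** The integrand is dominated by [p + q], since the cross term is nonnegative. *)
Lemma hellinger_integrable p q : density mu p -> density mu q ->
  mu.-integrable [set: T]
    (EFin \o (fun x => (Num.sqrt (p x) - Num.sqrt (q x)) ^+ 2)).
Proof.
move=> dp dq; have [mp p0 _] := dp; have [mq q0 _] := dq.
have msqrt (f : T -> R) : measurable_fun [set: T] f ->
    measurable_fun [set: T] (fun x => Num.sqrt (f x)).
  move=> mf; apply: measurableT_comp mf.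
  by apply: continuous_measurable_fun; exact: sqrt_continuous.
apply: (le_integrable measurableT _ _
  (integrable_EFin_linear 1 1 (density_integrable dp) (density_integrable dq))).
- apply/measurable_EFinP/measurable_funX.
  by apply: measurable_funB; exact: msqrt.
- move=> x _ /=; rewrite lee_fin !mul1r ger0_norm ?sqr_ge0// ger0_norm ?addr_ge0//.
  rewrite sqrrB !sqr_sqrtr//.
  have := mulr_ge0 (sqrtr_ge0 (p x)) (sqrtr_ge0 (q x)); lra.
Qed.

Lemma hellinger_ge0 p q : 0 <= hellinger mu p q.
Proof. exact: sqrtr_ge0. Qed.

Lemma hellinger_sqE p q : hellinger mu p q ^+ 2 =
  2^-1 * \int[mu]_x ((Num.sqrt (p x) - Num.sqrt (q x)) ^+ 2).
Proof.
by rewrite sqr_sqrtr// mulr_ge0// Rintegral_ge0// => x _; rewrite sqr_ge0.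
Qed.

Lemma hellinger_leE p q (r : R) : 0 <= r ->
  (hellinger mu p q <= r) = (hellinger mu p q ^+ 2 <= r ^+ 2).
Proof. by move=> r0; rewrite ler_pXn2r// nnegrE hellinger_ge0. Qed.

Lemma hellingerxx p : hellinger mu p p = 0.
Proof.
apply/eqP; rewrite -sqrf_eq0 hellinger_sqE.
under eq_Rintegral => x _ do rewrite subrr expr0n/=.
by rewrite Rintegral_cst// mul0r mulr0.
Qed.

Lemma hellingerC p q : hellinger mu p q = hellinger mu q p.
Proof.
by congr (Num.sqrt (_ * _)); apply: eq_Rintegral => x _; rewrite -sqrrN opprB.
Qed.

Lemma hellinger_sq_le1 p q : density mu p -> density mu q ->
  hellinger mu p q ^+ 2 <= 1.
Proof.
move=> dp dq; have [_ p0 intp] := dp; have [_ q0 intq] := dq.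
have := density_integrable dp; have := density_integrable dq => iq ip.
have : \int[mu]_x ((Num.sqrt (p x) - Num.sqrt (q x)) ^+ 2) <=
    \int[mu]_x (1 * p x + 1 * q x).
  apply: le_Rintegral => //; first exact: hellinger_integrable.
    exact: integrable_EFin_linear.
  move=> x _; rewrite !mul1r sqrrB !sqr_sqrtr//.
  have := mulr_ge0 (sqrtr_ge0 (p x)) (sqrtr_ge0 (q x)); lra.
rewrite Rintegral_linear// hellinger_sqE /Rintegral intp intq /=; lra.
Qed.

(** Stands in for the triangle inequality: at the level of squares it follows pointwise, without
    Minkowski. *)
Lemma hellinger_sq_quasi_triangle p q r :
  density mu p -> density mu q -> density mu r ->
  hellinger mu p r ^+ 2 <=
  2 * hellinger mu p q ^+ 2 + 2 * hellinger mu q r ^+ 2.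
Proof.
move=> dp dq dr; rewrite !hellinger_sqE.
have ipq := hellinger_integrable dp dq; have iqr := hellinger_integrable dq dr.
have : \int[mu]_x ((Num.sqrt (p x) - Num.sqrt (r x)) ^+ 2) <=
    \int[mu]_x (2 * (Num.sqrt (p x) - Num.sqrt (q x)) ^+ 2 +
                2 * (Num.sqrt (q x) - Num.sqrt (r x)) ^+ 2).
  apply: le_Rintegral => //; first exact: hellinger_integrable.
    exact: integrable_EFin_linear.
  move=> x _; rewrite -subr_ge0.
  set P := Num.sqrt (p x); set Q := Num.sqrt (q x); set S := Num.sqrt (r x).
  have -> : 2 * (P - Q) ^+ 2 + 2 * (Q - S) ^+ 2 - (P - S) ^+ 2 =
    (P - 2 * Q + S) ^+ 2 by ring.
  exact: sqr_ge0.
rewrite Rintegral_linear//; lra.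
Qed.

Lemma density_convex p q (t : R) : 0 <= t <= 1 ->
  density mu p -> density mu q -> density mu (fun x => (1 - t) * p x + t * q x).
Proof.
move=> /andP[t0 t1] dp dq; have [mp p0 intp] := dp; have [mq q0 intq] := dq.
have := density_integrable dp; have := density_integrable dq => iq ip.
split.
- by apply: measurable_funD; apply: measurable_funM.
- by move=> x; rewrite addr_ge0 ?mulr_ge0// subr_ge0.
- under eq_integral => x _ do rewrite EFinD !EFinM.
  rewrite integralD// ?integralZl//; last 2 first.
  + exact: (integrableZl measurableT (1 - t) ip).
  + exact: (integrableZl measurableT t iq).
  by rewrite intp intq !mule1 -EFinD subrK.
Qed.

Lemma hellinger_sq_convex p q r (t : R) : 0 <= t <= 1 ->
  density mu p -> density mu q -> density mu r ->
  hellinger mu r (fun x => (1 - t) * p x + t * q x) ^+ 2 <=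
  (1 - t) * hellinger mu r p ^+ 2 + t * hellinger mu r q ^+ 2.
Proof.
move=> t01 dp dq dr; rewrite !hellinger_sqE.
have irp := hellinger_integrable dr dp; have irq := hellinger_integrable dr dq.
have : \int[mu]_x ((Num.sqrt (r x) -
                    Num.sqrt ((1 - t) * p x + t * q x)) ^+ 2) <=
    \int[mu]_x ((1 - t) * (Num.sqrt (r x) - Num.sqrt (p x)) ^+ 2 +
                t * (Num.sqrt (r x) - Num.sqrt (q x)) ^+ 2).
  apply: le_Rintegral => //.
  - by apply: hellinger_integrable => //; exact: density_convex.
  - exact: integrable_EFin_linear.
  - by move=> x _; apply: sqrt_diff_sq_convex => //;
      [have [_ + _] := dp|have [_ + _] := dq]; exact.
rewrite Rintegral_linear//; lra.
Qed.

End HellingerTheory.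

(** * From packings to covers *)

Section LocalEntropy.
Context {d : measure_display} {T : measurableType d} {R : realType}.
Variable mu : {measure set T -> \bar R}.

Lemma covering_number_le_packing (F : set (T -> R)) (r : R) (K : nat) :
  0 <= r ->
  (forall N (q : 'I_N -> T -> R), (forall i, F (q i)) ->
    (forall i j, i != j -> r < hellinger mu (q i) (q j)) -> (N <= K)%N) ->
  (covering_number mu F r <= K%:R%:E)%E.
Proof.
move=> r0 packK.
(* Families are sequences of which only the first [N] terms matter, so a further point can be
   appended at index [N]. *)
pose P N := `[< exists q : nat -> T -> R,
  (forall i, (i < N)%N -> F (q i)) /\
  (forall i j, (i < j < N)%N -> r < hellinger mu (q j) (q i)) >].
have P0 : exists N, P N.
  exists 0%N; apply/asboolP; exists (fun=> fun=> 0).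
  by split => [i|i j]; rewrite ltn0 ?andbF.
have PK N : P N -> (N <= K)%N.
  move=> /asboolP[q [Fq sepq]]; apply: (packK N (q \o val)) => [i|i j ij] /=.
    exact/Fq/ltn_ord.
  case: (ltngtP i j) => [lt_ij|lt_ji|/val_inj eq_ij]; last by rewrite eq_ij eqxx in ij.
    by rewrite hellingerC sepq// lt_ij ltn_ord.
  by rewrite sepq// lt_ji ltn_ord.
case: (ex_maxnP P0 PK) => N PN maxN.
have [q [Fq sepq]] := asboolP _ PN.
have le_card : (q @` `I_N #<= `I_N)%card by exact: card_image_le.
apply: (@le_trans _ _ (counting (q @` `I_N))); last first.
  rewrite /counting asboolT; last by apply/finite_set_leP; exists N.
  by rewrite lee_fin ler_nat (leq_trans (geq_card_fset_set le_card))// PK.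
apply: ereal_inf_lbound; exists (q @` `I_N) => //; split.
  (* A point of [F] farther than [r] from every [q i] would extend the maximal family. *)
  by move=> _ [i iN <-]; exact: Fq.
move=> f Ff; apply: contrapT => farf.
suff /maxN : P N.+1 by rewrite ltnn.
apply/asboolP; exists (fun i => if i == N then f else q i); split.
  by move=> i; case: eqVneq => // iN; rewrite ltnS leq_eqVlt (negPf iN) => /Fq.
move=> i j /andP[ij]; rewrite ltnS leq_eqVlt.
case: (eqVneq j N) => [jN _|jN /= ltjN]; last first.
  by rewrite ltn_eqF ?(ltn_trans ij)// sepq// ij.
rewrite -jN ltn_eqF// ltNge; apply/negP => close; apply: farf.
by exists (q i) => //; exists i => //=; rewrite -jN.
Qed.

(** * Mixtures parametrised by free weights *)

Section Mixtures.
Variables (n : nat) (p : 'I_n.+1 -> T -> R).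
Hypothesis density_p : forall j, density mu (p j).

Lemma density_mixtures (q : T -> R) : mixtures p q -> density mu q.
Proof.
move=> [theta [theta0 theta1] <-]; split.
- apply: measurable_sum => j; apply: measurable_funM => //.
  by have [] := density_p j.
- move=> x; apply: sumr_ge0 => j _; rewrite mulr_ge0//.
  by have [_ + _] := density_p j.
- have int_p j := density_integrable (density_p j).
  under eq_integral => x _ do rewrite -sumEFin.
  rewrite integral_sum//; last first.
    by move=> j; exact: (integrableZl measurableT (theta j) (int_p j)).
  rewrite -[in RHS]theta1 -sumEFin; apply: eq_bigr => j _.
  under eq_integral => x _ do rewrite EFinM.
  rewrite (integralZl measurableT (int_p j)).
  by have [_ _ ->] := density_p j; rewrite mule1.
Qed.

(* Eliminating the last weight makes the coordinates free, so that the
   parameter set has nonempty interior in dimension [n] = [M - 1]. *)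
Let simplex : set ('I_n -> R) :=
  [set u | (forall j, 0 <= u j) /\ \sum_(j < n) u j <= 1].

Let mix (u : 'I_n -> R) : T -> R := fun x =>
  \sum_(j < n) u j * p (widen_ord (leqnSn n) j) x +
  (1 - \sum_(j < n) u j) * p ord_max x.

Let mixturesP (q : T -> R) : mixtures p q <-> exists2 u, simplex u & q = mix u.
Proof.
split=> [[theta [theta0 theta1] <-]|[u [u0 u1] ->]].
  rewrite big_ord_recr /= in theta1.
  exists (theta \o widen_ord (leqnSn n)).
    split=> [j|]; first exact: theta0.
    by rewrite -theta1 lerDl.
  apply/funext => x; rewrite big_ord_recr /=; congr (_ + _ * _).
  by apply/eqP; rewrite eq_sym subr_eq addrC theta1.
(* [insub] fails exactly at the last index, where the default value is the remaining weight. *)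
pose theta (j : 'I_n.+1) :=
  oapp u (1 - \sum_(j < n) u j) (insub (val j)).
have theta_widen j : theta (widen_ord (leqnSn n) j) = u j.
  by rewrite /theta /= valK.
have theta_max : theta ord_max = 1 - \sum_(j < n) u j.
  by rewrite /theta insubN//= ltnn.
exists theta; last first.
  apply/funext => x; rewrite big_ord_recr /= theta_max; congr (_ + _).
  by apply: eq_bigr => j _; rewrite theta_widen.
split=> [j|]; first by rewrite /theta; case: insub => [k|] /=; rewrite ?subr_ge0.
rewrite big_ord_recr /= theta_max.
by under eq_bigr do rewrite theta_widen; rewrite addrC subrK.
Qed.

Let sum_segment (t : R) (u v c : 'I_n -> R) :
  \sum_(j < n) segment t u v j * c j =
  (1 - t) * (\sum_(j < n) u j * c j) + t * (\sum_(j < n) v j * c j).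
Proof.
rewrite !mulr_sumr -big_split; apply: eq_bigr => j _.
by rewrite /segment /=; ring.
Qed.

Let sum_segment1 (t : R) (u v : 'I_n -> R) :
  \sum_(j < n) segment t u v j =
  (1 - t) * (\sum_(j < n) u j) + t * (\sum_(j < n) v j).
Proof. by rewrite !mulr_sumr -big_split. Qed.

Let mix_segment (t : R) (u v : 'I_n -> R) :
  mix (segment t u v) = fun x => (1 - t) * mix u x + t * mix v x.
Proof.
by apply/funext => x; rewrite /mix sum_segment sum_segment1; ring.
Qed.

Let simplex_segment (t : R) (u v : 'I_n -> R) : 0 <= t <= 1 ->
  simplex u -> simplex v -> simplex (segment t u v).
Proof.
move=> /andP[t0 t1] [u0 u1] [v0 v1]; split.
  by move=> j; rewrite addr_ge0 ?mulr_ge0// subr_ge0.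
by rewrite sum_segment1; nra.
Qed.

Let density_mix (u : 'I_n -> R) : simplex u -> density mu (mix u).
Proof. by move=> su; apply/density_mixtures/mixturesP; exists u. Qed.

Let hellinger_segment (t : R) (u v w : 'I_n -> R) : 0 <= t <= 1 ->
  simplex u -> simplex v -> simplex w ->
  hellinger mu (mix w) (mix (segment t u v)) ^+ 2 <=
  (1 - t) * hellinger mu (mix w) (mix u) ^+ 2 +
  t * hellinger mu (mix w) (mix v) ^+ 2.
Proof.
move=> t01 su sv sw; rewrite mix_segment.
by apply: hellinger_sq_convex => //; exact: density_mix.
Qed.

Lemma card_separated_mixtures (pstar : T -> R) (eta : R) (N : nat)
    (q : 'I_N -> T -> R) : 0 < eta -> mixtures p pstar ->
  (forall i, (hellinger_ball mu pstar eta `&` mixtures p) (q i)) ->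
  (forall i j, i != j -> eta / 2 < hellinger mu (q i) (q j)) ->
  (N <= 64 ^ n)%N.
Proof.
move=> eta0 /mixturesP[u0 su0 ->] ballq sepq.
pose E := [set u | simplex u /\ hellinger mu (mix u0) (mix u) ^+ 2 <= eta ^+ 2].
have /choice[x xP] i : exists u, E u /\ q i = mix u.
  have [[_ dq] /mixturesP[u su qu]] := ballq i.
  by exists u; split => //; split => //; rewrite -qu -hellinger_leE// ltW.
have t01 : 0 <= (64%:R^-1 : R) <= 1 by apply/andP; split; lra.
have segmentE i u : E u -> E (segment 64%:R^-1 (x i) u).
  move=> [su u_eta]; have [[sx x_eta] _] := xP i.
  split; first exact: simplex_segment.
  by apply: le_trans (hellinger_segment t01 sx su su0) _; lra.
(* Passing through [u0], the squared distance from [x i] to [u] is at most [4 eta^2]; the ratio 1/64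
   and convexity bring it down to [eta^2 / 16]. *)
have near_center i u : E u ->
    hellinger mu (mix (x i)) (mix (segment 64%:R^-1 (x i) u)) ^+ 2 <=
    eta ^+ 2 / 16.
  move=> [su u_eta]; have [[sx x_eta] _] := xP i.
  apply: le_trans (hellinger_segment t01 sx su sx) _.
  have := hellinger_sq_quasi_triangle
    (density_mix sx) (density_mix su0) (density_mix su).
  by rewrite hellingerxx expr0n/= [X in 2 * X ^+ 2]hellingerC; lra.
(* A common point would put [q i] and [q j] at squared distance at most
   [4 * eta^2 / 16 = (eta / 2)^2], against the strict separation. *)
have disjointE i j u v : E u -> E v ->
    segment 64%:R^-1 (x i) u = segment 64%:R^-1 (x j) v -> i = j.
  move=> Eu Ev eq_uv; apply/eqP/negPn/negP => /sepq.
  have [[sxi _] ->] := xP i; have [[sxj _] ->] := xP j.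
  rewrite ltNge => /negP; apply; rewrite hellinger_leE ?divr_ge0 ?(ltW eta0)//.
  have [sw _] := segmentE i u Eu.
  apply: le_trans (hellinger_sq_quasi_triangle
    (density_mix sxi) (density_mix sw) (density_mix sxj)) _.
  have := near_center i u Eu; have := near_center j v Ev.
  rewrite -eq_uv [X in _ + 2 * X ^+ 2 <= _]hellingerC.
  rewrite (_ : (eta / 2) ^+ 2 = eta ^+ 2 / 4); last by field.
  by lra.
(* Squared distances are at most 1, so by convexity the simplex shrunk by [t] towards [u0] stays in
   the ball. The simplex contains the cube of side [1 / n.+1] at the origin, whose shrunken copy has
   corner [(1 - t) * u0] and side [t / n.+1]. *)
pose t : R := Num.min 1 (eta ^+ 2).
have t_gt0 : 0 < t by rewrite lt_min ltr01 exprn_gt0.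
have t_le1 : t <= 1 by rewrite ge_min lexx.
have t_le_eta : t <= eta ^+ 2 by rewrite ge_min lexx orbT.
apply: (card_disjoint_homothets _ segmentE disjointE
  (a := fun j => (1 - t) * u0 j) (s := t / n.+1%:R)) => //.
- by rewrite divr_gt0.
- move=> u j [[u_ge0 u_le1] _]; rewrite u_ge0/=.
  by apply: le_trans u_le1; rewrite (bigD1 j)//= lerDl sumr_ge0.
- move=> u u_cube; pose v j := (u j - (1 - t) * u0 j) / t.
  have -> : u = segment t u0 v.
    apply/funext => j; rewrite /segment /v [t * _]mulrC divfK ?gt_eqF//.
    by ring.
  have sv : simplex v.
    split=> [j|].
      by have /andP[lo _] := u_cube j; rewrite divr_ge0 ?subr_ge0// ltW.
    apply: (@le_trans _ _ (\sum_(j < n) n.+1%:R^-1)).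
      apply: ler_sum => j _; have /andP[_ hi] := u_cube j.
      by rewrite ler_pdivrMr// [_ * t]mulrC lerBlDl.
    rewrite sumr_const card_ord -[X in X <= _]mulr_natl.
    by rewrite ler_pdivrMr// mul1r ler_nat.
  have t01' : 0 <= t <= 1 by rewrite t_le1 ltW.
  split; first exact: simplex_segment.
  apply: le_trans (hellinger_segment t01' su0 sv su0) _.
  rewrite hellingerxx expr0n/= mulr0 add0r (le_trans _ t_le_eta)//.
  by rewrite ler_piMr ?(ltW t_gt0)// hellinger_sq_le1//; exact: density_mix.
Qed.

End Mixtures.
End LocalEntropy.

Theorem theorem2 (d : measure_display) (T : measurableType d) (R : realType)
    (mu : {measure set T -> \bar R}) (M : nat) (hM : (2 <= M)%N)
    (p : 'I_M -> T -> R) (hp : forall j : 'I_M, density mu (p j))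
    (eps : R) (heps : 0 < eps) :
  (local_entropy mu (mixtures p) eps <= (64 ^+ (M - 1))%:E)%E.
Proof.
case: M hM p hp => // n _ p hp; rewrite subn1 /=.
apply: ge_ereal_sup => _ [pstar mix_pstar <-].
apply: ge_ereal_sup => _ [eta /= eps_eta <-].
(* A positive radius is what gives the set of weights a nonempty interior. *)
have eta0 : 0 < eta by exact: lt_le_trans eps_eta.
rewrite -natrX; apply: covering_number_le_packing => [|N q ballq sepq].
  by rewrite divr_ge0 ?ltW.
exact: card_separated_mixtures hp _ _ _ _ eta0 mix_pstar ballq sepq.
Qed.
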